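(* Let $n\ge1$ and let $\mathcal{J}$ be a non-trivial self-adjoint subspace of $SOH(n)$. Then the following are equivalent: (1) $\mathcal{J}$ is the kernel of some unital completely positive map with domain $SOH(n)$ (and codomain some operator system). (2) There exist $m<n$ and a surjective unital completely positive map $\phi:SOH(n)\to SOH(m)$ such that $\mathcal{J}=\ker(\phi)$. (3) There is a unital completely positive map $\phi:SOH(n)\to SOH(n)$ for which $\mathcal{J}=\ker(\phi)$.
   Context: For an integer $n\ge1$, $OH(n)$ is Pisier's self-dual operator space of dimension $n$: it has an orthonormal basis $e_1,\dots,e_n$ with $\|\sum_{i=1}^n A_i\otimes e_i\|=\|\sum_{i=1}^n A_i\otimes\overline{A_i}\|^{1/2}$ for all $p$ and all $A_i\in M_p$, where $\overline{A}$ is the entrywise complex conjugate and the norm on the right is that of $M_p\otimes M_p=M_{p^2}$. Fix a completely isometric inclusion $OH(n)\subseteq B(\mathcal{H})$. Let $H_0$ be the identity of $B(\mathcal{H}\oplus\mathcal{H})$ and $H_i=\begin{pmatrix}0&e_i\\ e_i^*&0\end{pmatrix}$, $1\le i\le n$. $SOH(n)\subseteq B(\mathcal{H}\oplus\mathcal{H})$ is the $(n+1)$-dimensional operator system spanned by $H_0,\dots,H_n$; for $n=0$ this is $SOH(0)=\mathbb{C}$ ($m=0$ is allowed in (2)). Non-trivial means $\mathcal{J}\ne\{0\}$. *)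

(* Defs.v *)
From HB Require Import structures.
From mathcomp Require Import all_boot all_order all_algebra.
From mathcomp Require Import complex mxtens.
From mathcomp Require Import mathcomp_extra boolp classical_sets functions reals.

Set Implicit Arguments.
Unset Strict Implicit.
Unset Printing Implicit Defensive.
Import Order.TTheory GRing.Theory Num.Theory.
Local Open Scope classical_set_scope.
Local Open Scope ring_scope.

Section Hilbert.
Variable R : realType.
Local Notation C := R[i].

Definition hnorm (U : lmodType C) (dot : {dot U for Num.conj}) (x : U) : R :=
  Num.sqrt (complex.Re (dot x x)).

Record hilbert := Hilbert {
  hspace :> lmodType C;
  (* linear in the first variable, conjugate-linear in the second *)
  hdot : {dot hspace for Num.conj};
  hcomplete : forall u : nat -> hspace,
    (forall eps : R, 0 < eps -> exists N : nat, forall m n,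
      (N <= m)%N -> (N <= n)%N -> hnorm hdot (u m - u n) < eps) ->
    exists l : hspace, forall eps : R, 0 < eps ->
      exists N : nat, forall n, (N <= n)%N -> hnorm hdot (u n - l) < eps
}.

Definition opnorm (U : Type) (N : U -> R) (T : U -> U) : R :=
  sup [set N (T x) | x in [set x | N x <= 1]].

Definition mxnorm (N : nat) (A : 'M[C]_N) : R :=
  opnorm (fun v : 'cV[C]_N => hnorm (@dotmx C N) v^T) (mulmx A).

End Hilbert.

Section BoundedOperators.
Variable R : realType.
Local Notation C := R[i].
Variable H : hilbert R.

Definition bounded_op : {pred (H -> H)} := fun f =>
  `[< linear f /\
      exists M : R, forall x, hnorm (hdot H) (f x) <= M * hnorm (hdot H) x >].

Let nrm2 (x : H) : R := complex.Re (hdot H x x).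

Let nrm2_ge0 x : 0 <= nrm2 x.
Proof. by have := dnorm_ge0 (hdot H) x; rewrite lecE => /andP[]. Qed.

Let nrm2D x y : nrm2 (x + y) <= 2 * nrm2 x + 2 * nrm2 y.
Proof.
have -> : 2 * nrm2 x + 2 * nrm2 y = nrm2 (x + y) + nrm2 (x - y).
  rewrite /nrm2 -!raddfD/= dnormD dnormB addrACA subrr addr0.
  by rewrite !raddfD/= !mulr_natl !mulr2n addrACA.
by rewrite lerDl.
Qed.

Let nrm2Z a x : nrm2 (a *: x) = (complex.Re `|a|) ^+ 2 * nrm2 x.
Proof.
rewrite /nrm2 dnormZ.
have /complex_realP[r ->] : `|a| \is Num.real by exact: normr_real.
by case: (hdot H x x) => u v; rewrite -rmorphXn /= mul0r subr0.
Qed.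

Lemma bounded_opP (f : H -> H) : reflect
  (linear f /\ exists M : R, 0 <= M /\ forall x,
     complex.Re (hdot H (f x) (f x)) <= M * complex.Re (hdot H x x))
  (f \in bounded_op).
Proof.
apply: (iffP (asboolP _)) => -[linf [M fM]]; split=> //.
  exists (M ^+ 2); split; first exact: sqr_ge0.
  move=> x; have := fM x; rewrite -!/(nrm2 _) /hnorm -!/(nrm2 _) => fMx.
  rewrite -[leLHS]sqr_sqrtr ?nrm2_ge0// -[nrm2 x]sqr_sqrtr ?nrm2_ge0//.
  rewrite -exprMn; apply: lerXn2r => //; rewrite nnegrE ?sqrtr_ge0//.
  by apply: le_trans fMx; exact: sqrtr_ge0.
have [M0 fM2] := fM; exists (Num.sqrt M) => x; rewrite /hnorm -sqrtrM//.
by apply: ler_wsqrtr; exact: fM2.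
Qed.

Lemma bounded_op_submod : submod_closed bounded_op.
Proof.
split=> [|a f g /bounded_opP[linf [M [M0 fM]]] /bounded_opP[ling [N [N0 gN]]]].
  apply/bounded_opP; split; first by move=> a x y /=; rewrite scaler0 addr0.
  by exists 0; split=> // x; rewrite mul0r /= linear0r.
apply/bounded_opP; split.
  move=> b x y /=; rewrite !fctE linf ling !scalerDr !scalerA addrACA.
  by rewrite mulrC.
exists (2 * (complex.Re `|a| ^+ 2 * M) + 2 * N); split.
  by rewrite addr_ge0// mulr_ge0// mulr_ge0// sqr_ge0.
move=> x; rewrite !fctE -!/(nrm2 _); apply: le_trans (nrm2D _ _) _.
rewrite nrm2Z; move: (_ ^+ 2) (sqr_ge0 (complex.Re `|a|)) => c c0.
rewrite [leRHS]mulrDl -!mulrA; apply: lerD; rewrite ler_wpM2l//; last exact: gN.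
by rewrite ler_wpM2l//; exact: fM.
Qed.

HB.instance Definition _ := GRing.isSubmodClosed.Build C (H -> H) bounded_op
  bounded_op_submod.

Record bop := Bop { bop_fun :> H -> H; bop_funP : bop_fun \in bounded_op }.

HB.instance Definition _ := [isSub for bop_fun].
HB.instance Definition _ := [Choice of bop by <:].
HB.instance Definition _ := [SubChoice_isSubLmodule of bop by <:].

Lemma bop_linear (T : bop) : linear T.
Proof. by case/bounded_opP: (bop_funP T). Qed.

HB.instance Definition _ (T : bop) :=
  GRing.isLinear.Build C H H *:%R T (bop_linear T).

Lemma idfun_bounded : idfun \in bounded_op.
Proof.
apply/bounded_opP; split=> //; exists 1; split=> // x.
by rewrite mul1r.
Qed.

Definition bop_id : bop := Bop idfun_bounded.

(* By the Riesz representation theorem every bounded operator has an adjoint,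
   so the default value 0 is never taken. *)
Definition adj (T : bop) : bop :=
  xget 0 [set S : bop | forall x y, hdot H (T x) y = hdot H x (S y)].

Definition positive_op (T : bop) : Prop := forall x, 0 <= hdot H (T x) x.

End BoundedOperators.
Arguments bounded_op {R} H _.

Section HilbertSum.
Variable R : realType.
Local Notation C := R[i].
Variables (p : nat) (H : hilbert R).

Definition hsum_dot (x y : {ffun 'I_p -> H}) : C := \sum_i hdot H (x i) (y i).

Lemma hsum_dot_bilinear : bilinear_for (GRing.mul : GRing.Scale.law C C)
  (Num.conj \; *%R : GRing.Scale.law C C) hsum_dot.
Proof.
split=> [y|x] a u v; rewrite /hsum_dot /= mulr_sumr -big_split/=.
  by apply: eq_bigr => i _; rewrite !ffunE linearPl.
by apply: eq_bigr => i _; rewrite !ffunE linearPr.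
Qed.

HB.instance Definition _ :=
  bilinear_isBilinear.Build C _ _ C *%R (Num.conj \; *%R) hsum_dot hsum_dot_bilinear.

Lemma hsum_dot_hermitian x y :
  hsum_dot x y = (-1) ^+ false * Num.conj (hsum_dot y x).
Proof.
rewrite mul1r rmorph_sum; apply: eq_bigr => i _.
by rewrite hermC mul1r.
Qed.

HB.instance Definition _ :=
  isHermitianSesquilinear.Build C _ false Num.conj hsum_dot hsum_dot_hermitian.

Lemma hsum_dot_gt0 x : x != 0 -> 0 < hsum_dot x x.
Proof.
move=> x0; rewrite lt_def sumr_ge0 ?andbT; last by move=> i _.
apply: contra x0 => /eqP; rewrite /hsum_dot => /psumr_eq0P h0.
apply/eqP/ffunP => i; rewrite ffunE; apply/eqP.
by rewrite -(dnorm_eq0 (hdot H)) h0.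
Qed.

HB.instance Definition _ := isDotProduct.Build C _ hsum_dot hsum_dot_gt0.

Let hsum_norm_sqr (x : {ffun 'I_p -> H}) :
  hnorm hsum_dot x ^+ 2 = \sum_i hnorm (hdot H) (x i) ^+ 2.
Proof.
have nn (U : lmodType C) (d : {dot U for Num.conj}) z :
    hnorm d z ^+ 2 = complex.Re (d z z).
  rewrite sqr_sqrtr//; have := dnorm_ge0 d z.
  by rewrite lecE => /andP[].
by rewrite nn raddf_sum; apply: eq_bigr => i _; rewrite nn.
Qed.

Let hnorm_ge0 (U : lmodType C) (d : {dot U for Num.conj}) z : 0 <= hnorm d z.
Proof. exact: sqrtr_ge0. Qed.

Lemma hsum_complete (u : nat -> {ffun 'I_p -> H}) :
  (forall eps : R, 0 < eps -> exists N : nat, forall m n,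
      (N <= m)%N -> (N <= n)%N -> hnorm hsum_dot (u m - u n) < eps) ->
    exists l, forall eps : R, 0 < eps ->
      exists N : nat, forall n, (N <= n)%N -> hnorm hsum_dot (u n - l) < eps.
Proof.
move=> cu.
have /choice[l lP] : forall i : 'I_p, exists l : H, forall eps : R, 0 < eps ->
    exists N : nat, forall n, (N <= n)%N -> hnorm (hdot H) (u n i - l) < eps.
  move=> i; apply: (@hcomplete _ H (fun n => u n i)) => eps /cu[N NP].
  exists N => m n Nm Nn; apply: le_lt_trans (NP m n Nm Nn).
  rewrite -ler_sqr ?nnegrE ?hnorm_ge0// hsum_norm_sqr (bigD1 i)//= !ffunE.
  by rewrite lerDl sumr_ge0// => j _; exact: sqr_ge0.
exists (finfun l) => eps eps0; pose d := eps / p.+1%:R.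
have d0 : 0 < d by rewrite divr_gt0// ltr0n.
have /choice[N NP] := fun i => lP i d d0.
exists (\max_i N i)%N => n Nn.
rewrite -ltr_sqr ?nnegrE ?hnorm_ge0 ?(ltW eps0)// hsum_norm_sqr.
apply: (@le_lt_trans _ _ (\sum_(i < p) d ^+ 2)).
  apply: ler_sum => i _; rewrite !ffunE ler_sqr ?nnegrE ?hnorm_ge0 ?ltW//.
  by apply: NP; apply: leq_trans Nn; exact: (leq_bigmax i).
rewrite sumr_const card_ord -mulr_natl.
have -> : eps = p.+1%:R * d by rewrite /d mulrCA divff ?mulr1// pnatr_eq0.
rewrite [ltRHS]exprMn ltr_pM2r ?exprn_gt0// -natrX ltr_nat.
by rewrite expnS expn1 mulSn addSn ltnS leq_addr.
Qed.

Definition hsum : hilbert R := Hilbert hsum_complete.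

Definition mx_fun (X : 'M[bop H]_p) (x : hsum) : hsum :=
  [ffun k => \sum_l X k l (x l)].

Lemma mx_fun_bounded X : mx_fun X \in bounded_op hsum.
Proof.
pose F k l (x : hsum) : hsum := [ffun k' => if k' == k then X k l (x l) else 0].
have -> : mx_fun X = \sum_k \sum_l F k l.
  apply/funext => x; apply/ffunP => k; rewrite ffunE !fct_sumE sum_ffunE.
  rewrite [RHS](bigD1 k)//= [X in _ + X]big1 ?addr0 => [|k' /negPf k'k].
    by rewrite fct_sumE sum_ffunE; apply: eq_bigr => l _; rewrite ffunE eqxx.
  rewrite fct_sumE sum_ffunE big1// => l _.
  by rewrite ffunE eq_sym k'k.
apply: rpred_sum => k _; apply: rpred_sum => l _.
have /bounded_opP[linX [M [M0 XM]]] := bop_funP (X k l).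
apply/bounded_opP; split=> [a x y|].
  apply/ffunP => k'; rewrite !ffunE; case: ifP => _; first exact: linX.
  by rewrite scaler0 addr0.
exists M; split=> // x; rewrite /= /hsum_dot (bigD1 k)//= ffunE eqxx.
rewrite big1 => [|k' /negPf k'k]; last by rewrite ffunE k'k linear0r.
rewrite addr0; apply: le_trans (XM _) _; rewrite ler_wpM2l//.
rewrite (bigD1 l)//= raddfD/= lerDl raddf_sum sumr_ge0// => i _.
by have := dnorm_ge0 (hdot H) (x i); rewrite lecE => /andP[].
Qed.

(* The identification of M_p(B(H)) with B(H^p). *)
Definition mx_op (X : 'M[bop H]_p) : bop hsum := Bop (mx_fun_bounded X).

End HilbertSum.

Section OperatorSystems.
Variable R : realType.
Local Notation C := R[i].

Definition subspace (V : lmodType C) (S : set V) : Prop :=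
  S 0 /\ forall (a : C) u v, S u -> S v -> S (a *: u + v).

Definition selfadjoint_set (H : hilbert R) (S : set (bop H)) : Prop :=
  forall T, S T -> S (adj T).

(* The zero space is not an operator system: its unit would be 0, and every
   space would be the kernel of a unital completely positive map into it. *)
Definition operator_system (H : hilbert R) (S : set (bop H)) : Prop :=
  [/\ exists x : H, x != 0, subspace S, selfadjoint_set S & S (bop_id H)].

(* A map with domain the operator system S is represented by a total function,
   whose values outside S are irrelevant. *)
Definition completely_positive (H K : hilbert R) (S : set (bop H))
    (phi : bop H -> bop K) : Prop :=
  forall (p : nat) (X : 'M[bop H]_p), (forall k l, S (X k l)) ->
    positive_op (mx_op X) -> positive_op (mx_op (map_mx phi X)).

Definition ucp (H K : hilbert R) (S : set (bop H)) (T : set (bop K))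
    (phi : bop H -> bop K) : Prop :=
  [/\ forall x, S x -> T (phi x),
      forall (a : C) x y, S x -> S y -> phi (a *: x + y) = a *: phi x + phi y,
      phi (bop_id H) = bop_id K
    & completely_positive S phi].

Definition kernel (H K : hilbert R) (S : set (bop H)) (phi : bop H -> bop K) :
  set (bop H) := [set x | S x /\ phi x = 0].

(* A completely isometric inclusion of OH(n) in B(H), given by the images of
   its canonical basis. The condition [oh_neq0] matters only when n = 0, where
   it ensures that SOH(0) is one-dimensional. *)
Record OH_inclusion (n : nat) := OHInclusion {
  oh_space :> hilbert R;
  oh_neq0 : exists x : oh_space, x != 0;
  oh_basis : 'I_n -> bop oh_space;
  oh_norm : forall (p : nat) (A : 'I_n -> 'M[C]_p),
    opnorm (hnorm (hdot (hsum p oh_space)))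
      (mx_op (\matrix_(k, l) \sum_i A i k l *: oh_basis i)) =
    Num.sqrt (mxnorm (\sum_i A i *t map_mx Num.conj (A i)))
}.

Definition SOH_space (n : nat) (E : OH_inclusion n) : hilbert R := hsum 2 E.

Definition SOH_gen (n : nat) (E : OH_inclusion n) (i : 'I_n) :
    bop (SOH_space E) :=
  mx_op (block_mx (0 : 'M_1) (const_mx (oh_basis E i))
                  (const_mx (adj (oh_basis E i))) (0 : 'M_1)).

Definition SOH (n : nat) (E : OH_inclusion n) : set (bop (SOH_space E)) :=
  [set T | exists (a0 : C) (a : 'I_n -> C),
    T = a0 *: bop_id (SOH_space E) + \sum_i a i *: SOH_gen E i].

End OperatorSystems.

Arguments SOH {R n} E _.

(* Main.v *)
Require Import Defs.
From mathcomp Require Import all_boot all_order all_algebra.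
From mathcomp Require Import complex ring lra.
From mathcomp Require Import boolp classical_sets reals.

Set Implicit Arguments.
Unset Strict Implicit.
Unset Printing Implicit Defensive.
Import Order.TTheory GRing.Theory Num.Theory.
Local Open Scope classical_set_scope.
Local Open Scope ring_scope.

(** Let phi be a unital completely positive map on SOH(n) with kernel J. The
operator phi x vanishes exactly when all the numbers <phi x v, v>, v a unit
vector, vanish; hence J is the common kernel of the vector states
s_v x = <phi x v, v>. These functionals live in a space of dimension n + 1,
so finitely many of them, s_0, ..., s_m, linearly independent, already have
common kernel J, and m < n because J is not zero
([separating_vector_states]).

A state takes positive matrices over SOH(n) to positive scalar matrices, so
for positive operators P_0, ..., P_k of SOH(k) with sum 1 the map
  psi x = \sum_i s_i x P_i
is completely positive and unital, whatever the states s_i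
([vector_state_cp]; the point is that a positive scalar matrix and the
positive Gram matrix of the <P_i xi_l, xi_k> pair to a nonnegative number).
SOH(k) has a basis of positive elements with sum 1
([SOH_positive_basis]): rescale the elements 1 + d_i H_i, which are positive
for small d_i because H_i is self-adjoint and bounded, and complete them by
the difference with 1. With such a basis, psi has kernel J, and it is onto
when the s_i are independent ([replace_codomain]). Taking k = m gives the
surjection onto SOH(m); taking k = n and repeating some of the states gives
the map into SOH(n). Conversely, maps into SOH(m) or SOH(n) are maps into an
operator system.

The norm formula of OH(n) enters through the linear independence of
1, H_1, ..., H_n ([oh_basis_free]). That H_i is self-adjoint rests on the
existence of adjoints of bounded operators, hence on the Riesz representation
theorem ([riesz]). *)

(** * Hilbert spaces: Riesz representation and adjoints *)

Lemma Re_realM (R : realType) (t : R) (z : R[i]) :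
  complex.Re (t%:C%C * z) = t * complex.Re z.
Proof. by case: z => u v /=; rewrite mul0r subr0. Qed.

Section Riesz.
Variables (R : realType) (H : hilbert R).
Local Notation C := R[i].
Local Notation dot := (hdot H).

(** The real part of the inner product is a real inner product, so that the
Riesz theorem can be proved by real quadratic arithmetic. *)
Definition redot (x y : H) : R := complex.Re (dot x y).
Local Notation b := redot.
Local Notation q x := (redot x x).

Lemma redot_ge0 x : 0 <= q x.
Proof. by have := dnorm_ge0 dot x; rewrite lecE => /andP[]. Qed.

Lemma dotxx x : dot x x = (q x)%:C%C.
Proof. by rewrite RRe_real// ger0_real// dnorm_ge0. Qed.

Lemma redot_eq0 x : q x = 0 -> x = 0.
Proof. by move=> q0; apply/eqP; rewrite -(dnorm_eq0 dot) dotxx q0. Qed.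

Lemma dotC x y : dot y x = Num.conj (dot x y).
Proof. by rewrite hermC mul1r. Qed.

Lemma hnorm0 : hnorm dot 0 = 0.
Proof. by rewrite /hnorm linear0l sqrtr0. Qed.

Lemma dotDl x y z : dot (x + y) z = dot x z + dot y z.
Proof. exact: linearDl. Qed.

Lemma dotDr x y z : dot x (y + z) = dot x y + dot x z.
Proof. exact: linearDr. Qed.

Lemma dot_suml (I : Type) (r : seq I) (f : I -> H) x :
  dot (\sum_(i <- r) f i) x = \sum_(i <- r) dot (f i) x.
Proof. exact: linear_sumlz. Qed.

Lemma dot_sumr (I : Type) (r : seq I) (f : I -> H) x :
  dot x (\sum_(i <- r) f i) = \sum_(i <- r) dot x (f i).
Proof. exact: raddf_sum. Qed.

Lemma dotZl a x y : dot (a *: x) y = a * dot x y.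
Proof. exact: linearZl_LR. Qed.

Lemma dotZr a x y : dot x (a *: y) = Num.conj a * dot x y.
Proof. exact: linearZr_LR. Qed.

Lemma redotC x y : b x y = b y x.
Proof. by rewrite /b dotC; case: (dot y x). Qed.

Lemma redotDl x y z : b (x + y) z = b x z + b y z.
Proof. by rewrite /b linearDl raddfD. Qed.

Lemma redotDr x y z : b x (y + z) = b x y + b x z.
Proof. by rewrite /b linearDr raddfD. Qed.

Lemma redotZl (t : R) x y : b (t%:C%C *: x) y = t * b x y.
Proof. by rewrite /b dotZl Re_realM. Qed.

Lemma redotZr (t : R) x y : b x (t%:C%C *: y) = t * b x y.
Proof. by rewrite redotC redotZl redotC. Qed.

Lemma redotNr x y : b x (- y) = - b x y.
Proof. by rewrite /b linearNr raddfN. Qed.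

Lemma redotNl x y : b (- x) y = - b x y.
Proof. by rewrite redotC redotNr redotC. Qed.

(** The Cauchy-Schwarz inequality: the square norm of x - t y is nonnegative
at the minimising t. *)
Lemma redot_cauchy x y : b x y ^+ 2 <= q x * q y.
Proof.
have [qy0|qy0] := eqVneq (q y) 0.
  by rewrite (redot_eq0 qy0) /b linear0r expr0n mulr_ge0 ?redot_ge0.
have qy : 0 < q y by rewrite lt_def qy0 redot_ge0.
have := redot_ge0 (x + (- b x y / q y)%:C%C *: y).
rewrite !(redotDl, redotDr, redotZl, redotZr) (redotC y x).
have -> : q x + - b x y / q y * b x y
   + (- b x y / q y * b x y + - b x y / q y * (- b x y / q y * q y))
   = (q x * q y - b x y ^+ 2) / q y by field.
by rewrite pmulr_lge0 ?invr_gt0// subr_ge0.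
Qed.

Lemma redot_i x y : b ('i%C *: x) y = - complex.Im (dot x y).
Proof.
by rewrite /b dotZl; case: (dot x y) => u v /=; rewrite mul0r mul1r sub0r.
Qed.

Lemma dot_ext x y : (forall z, b z x = b z y) -> x = y.
Proof.
move=> h; apply/eqP; rewrite -subr_eq0; apply/eqP/redot_eq0.
by rewrite redotDr redotNr h subrr.
Qed.

Lemma hnorm_lt x (eps : R) : 0 < eps -> (hnorm dot x < eps) = (q x < eps ^+ 2).
Proof.
by move=> e0; rewrite -[eps in LHS]gtr0_norm// -sqrtr_sqr ltr_sqrt// exprn_gt0.
Qed.

(** The representing vector is the minimiser of the functional
g x = |x|^2 - 2 Re (f x), which is bounded below because f is bounded.
Minimising sequences are Cauchy by the parallelogram identity [g_par], and the
variational inequality [g_var] shows that near-minimisers almost represent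
Re f; these two estimates pass to the limit. *)
Lemma riesz (f : H -> C) (M : R) :
    (forall a x y, f (a *: x + y) = a * f x + f y) -> 0 <= M ->
    (forall x, complex.Re (f x) ^+ 2 <= M * q x) ->
  exists z, forall x, f x = dot x z.
Proof.
move=> linf M0 fM.
pose rf x := complex.Re (f x).
have rfE (t : R) x y : rf (x + t%:C%C *: y) = rf x + t * rf y.
  rewrite /rf addrC linf; case: (f x) (f y) => a c [d e] /=.
  by rewrite mul0r subr0 addrC.
pose g x := q x - 2 * rf x.
have gM x : - M <= g x.
  have := fM x; have := redot_ge0 x; rewrite /g -/(rf x).
  have := sqr_ge0 (M - q x).
  by case: (leP (2 * rf x) (M + q x)); nra.
pose A := range g.
have A0 : A !=set0 by exists (g 0), 0.
have Alb : has_lbound A by exists (- M) => _ [x _ <-].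
pose I := inf A.
have gI x : I <= g x by apply: ge_inf => //; exists x.
have /choice[u uI] (n : nat) : exists x, g x < I + n.+1%:R^-1.
  have n0 : 0 < (n.+1%:R^-1 : R) by rewrite invr_gt0.
  by have [_ [x _ <-] xI] := inf_adherent n0 (conj A0 Alb); exists x.
have rf0 : rf 0 = 0.
  have := rfE 1 0 0; rewrite scaler0 addr0 mul1r => /esym/eqP.
  by rewrite -subr_eq0 addrK => /eqP.
have rfZ t x : rf (t%:C%C *: x) = t * rf x by rewrite -[_ *: _]add0r rfE rf0 add0r.
have rfD x y : rf (x + y) = rf x + rf y.
  by rewrite -[y in LHS]scale1r (rfE 1) mul1r.
(* The infimum bounds the value of g at the midpoint of x and y. *)
have g_par x y : q (x - y) <= 2 * (g x - I) + 2 * (g y - I).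
  have := gI ((1 / 2)%:C%C *: (x + y)); rewrite /g rfZ rfD.
  rewrite !(redotDl, redotDr, redotZl, redotZr, redotNl, redotNr) (redotC y x).
  lra.
(* The infimum bounds g along the line x + t y; t is the minimising value. *)
have g_var x y : (b y x - rf y) ^+ 2 <= (g x - I) * q y.
  have [qy0|qy0] := eqVneq (q y) 0.
    by rewrite (redot_eq0 qy0) rf0 /b linear0l subrr expr0n /= linear0l mulr0.
  have qy : 0 < q y by rewrite lt_def qy0 redot_ge0.
  have := gI (x + (- (b y x - rf y) / q y)%:C%C *: y); rewrite /g rfE.
  rewrite !(redotDl, redotDr, redotZl, redotZr) (redotC x y) -subr_ge0.
  set c := b y x - rf y.
  set lhs := (X in 0 <= X -> _).
  have -> : lhs = ((q x - 2 * rf x - I) * q y - c ^+ 2) / q y.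
    by rewrite /lhs /c; field.
  by rewrite pmulr_lge0 ?invr_gt0// subr_ge0.
have small (eps : R) : 0 < eps -> exists N : nat, forall n, (N <= n)%N -> g (u n) - I < eps.
  move=> eps0; exists (Num.truncn (eps^-1)) => n Nn.
  have := uI n; rewrite -ltrBlDl => /lt_le_trans; apply.
  rewrite invf_ple ?posrE// ltW// (lt_le_trans (truncnS_gt _))//.
  by rewrite ler_nat ltnS.
have [|z uz] := @hcomplete _ H u.
  move=> eps eps0; have [|N NP] := small (eps ^+ 2 / 4).
    by rewrite divr_gt0// exprn_gt0.
  exists N => m n /NP um /NP un; rewrite hnorm_lt//.
  by have := g_par (u m) (u n); lra.
exists z.
have fz x : rf x = b x z.
  apply/eqP; rewrite eq_sym -subr_eq0 -sqrf_eq0; apply/eqP/le_anti; rewrite sqr_ge0 andbT.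
  apply/ler_addgt0Pl => eps eps0; rewrite addr0.
  pose d := eps / (4 * (q x + 1)).
  have qx := redot_ge0 x.
  have d0 : 0 < d by rewrite divr_gt0//; lra.
  have [N NP] := small d d0.
  have [|N' NP'] := uz (Num.sqrt d); first by rewrite sqrtr_gt0.
  have := NP _ (leq_maxl N N').
  have := NP' _ (leq_maxr N N'); rewrite hnorm_lt ?sqrtr_gt0// sqr_sqrtr ?(ltW d0)//.
  move: (u (maxn N N')) => w qw gw.
  have := g_var w x.
  have := redot_cauchy x (w - z); rewrite redotDr redotNr.
  have de : d * (4 * (q x + 1)) = eps by rewrite /d divfK// gt_eqF//; lra.
  have := sqr_ge0 (b x w - b x z + (b x w - rf x)).
  have : q (w - z) * q x <= d * q x by apply: ler_wpM2r => //; exact: ltW.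
  have : (g w - I) * q x <= d * q x by apply: ler_wpM2r => //; exact: ltW.
  lra.
(* The imaginary part of f x is minus the real part of f (i x). *)
move=> x; have := fz x; have := fz ('i%C *: x).
rewrite redot_i /rf.
have -> : f ('i%C *: x) = 'i%C * f x.
  have := linf 1 0 0; rewrite scaler0 addr0 mul1r => /esym/eqP.
  rewrite -subr_eq0 addrK => /eqP f0.
  by have := linf 'i%C x 0; rewrite addr0 f0 addr0.
rewrite /b; case: (f x) (dot x z) => a c [d e] /=.
by rewrite mul0r mul1r sub0r => /oppr_inj -> ->.
Qed.

(** Each functional x |-> <T x, y> is bounded, so [riesz] represents it by a
vector S y, and then |S y|^2 = <T (S y), y> <= |T (S y)| |y| bounds S. *)
Lemma adjP (T : bop H) x y : dot (T x) y = dot x (adj T y).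
Proof.
move: x y; rewrite /adj; case: xgetP => [S _ //|].
have /bounded_opP[_ [M [M0 TM]]] := bop_funP T.
have /choice[S SP] y : exists z, forall x, dot (T x) y = dot x z.
  apply: (@riesz (fun x => dot (T x) y) (M * q y)) => [a u v|//|x].
  - by rewrite linearP linearPl.
  - by rewrite mulr_ge0// redot_ge0.
  - apply: le_trans (redot_cauchy _ _) _.
    rewrite mulrAC ler_wpM2r ?redot_ge0//; exact: TM.
have SB : S \in bounded_op H.
  apply/bounded_opP; split=> [a x y|].
    by apply: dot_ext => z; rewrite /b -SP !linearPr /= !SP.
  exists M; split=> // x.
  rewrite -/(q (S x)) -/(q x).
  have [Sx0|Sx0] := eqVneq (q (S x)) 0.
    by rewrite Sx0 mulr_ge0// redot_ge0.
  have Sx : 0 < q (S x) by rewrite lt_def Sx0 redot_ge0.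
  have qE : q (S x) = b (T (S x)) x by rewrite /b SP.
  have := redot_cauchy (T (S x)) x; rewrite -qE => h.
  rewrite -(ler_pM2l Sx) -expr2 (le_trans h)// mulrA ler_wpM2r ?redot_ge0//.
  by rewrite mulrC; exact: TM.
by move=> /(_ (Bop SB)) [] x y; exact: SP.
Qed.

Lemma adj_unique (T S : bop H) : (forall x y, dot (T x) y = dot x (S y)) -> adj T = S.
Proof.
move=> h; apply/val_inj/funext => y; apply: dot_ext => x.
by rewrite /b -adjP h.
Qed.

End Riesz.

(** * Quadratic forms of bounded operators *)

Section Polarization.
Variables (R : realType) (H : hilbert R).
Local Notation C := R[i].
Local Notation dot := (hdot H).

Lemma bop_scaleE (a : C) (T : bop H) x : (a *: T) x = a *: T x.
Proof. by []. Qed.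

Lemma bop_addE (T S : bop H) x : (T + S) x = T x + S x.
Proof. by []. Qed.

Lemma bopZ (T : bop H) a x : T (a *: x) = a *: T x.
Proof. exact: linearZ. Qed.

Lemma bop_sumr (I : Type) (r : seq I) (T : bop H) (f : I -> H) :
  T (\sum_(i <- r) f i) = \sum_(i <- r) T (f i).
Proof. exact: raddf_sum. Qed.

Lemma bop_sum (I : Type) (r : seq I) (T : I -> bop H) x :
  (\sum_(i <- r) T i) x = \sum_(i <- r) T i x.
Proof.
elim: r => [|i r IH]; first by rewrite !big_nil.
by rewrite !big_cons -IH.
Qed.

(** Polarization: over the complex numbers the quadratic form determines the
operator; this is what makes vector states separate operators. *)
Lemma quadratic_form_eq0 (T : bop H) : (forall x, dot (T x) x = 0) -> T = 0.
Proof.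
move=> T0; have pol x y : dot (T x) y + dot (T y) x = 0.
  have := T0 (x + y); rewrite [T _]linearD !dotDl !dotDr !T0.
  by rewrite add0r addr0 addrC.
have pol_i x y : dot (T x) y = dot (T y) x.
  have /eqP := pol ('i *: x) y.
  rewrite bopZ dotZl dotZr addr_eq0.
  by rewrite conjCi mulNr opprK => /eqP /mulfI; apply; rewrite neq0Ci.
apply/val_inj/funext => x; apply/eqP; rewrite -(dnorm_eq0 dot) /=.
have := pol x (T x); rewrite -pol_i -mulr2n => /eqP.
by rewrite mulrn_eq0.
Qed.

Lemma positive_op_adj (T : bop H) : positive_op T -> adj T = T.
Proof.
move=> T0; apply/esym/eqP; rewrite -subr_eq0; apply/eqP/quadratic_form_eq0 => x.
by rewrite [(T - _) x]/(T x - adj T x) linearBl /= (dotC x (adj T x)) -adjP geC0_conj ?subrr//.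
Qed.

End Polarization.

(** * Complete positivity *)

(** By the spectral theorem Q = U^* d U with d >= 0, so B = sqrt d U will do. *)
Lemma gram_decomposition (R : realType) p (Q : 'M[R[i]]_p) :
    (forall k l, Q l k = (Q k l)^*) ->
    (forall c : 'I_p -> R[i], 0 <= \sum_k \sum_l (c k)^* * c l * Q k l) ->
  exists B : 'M_p, forall k l, Q k l = \sum_r (B r k)^* * B r l.
Proof.
move=> Qh Q0.
have /hermitian_normalmx/orthomx_spectralP QE : Q \is hermsymmx.
  by apply/is_hermitianmxP/matrixP => k l; rewrite expr0 scale1r !mxE Qh.
have := spectral_unitarymx Q; move: (spectralmx Q) (spectral_diag Q) QE => U d QE Uu.
rewrite (invmx_unitary Uu) in QE.
have dE : diag_mx d = U *m Q *m map_mx Num.conj U^T.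
  have /unitarymxP UU := Uu.
  by rewrite QE !mulmxA UU mul1mx -mulmxA UU mulmx1.
have d0 r : 0 <= d 0 r.
  have := Q0 (fun l => (U r l)^*); congr (0 <= _).
  have -> : d 0 r = diag_mx d r r by rewrite mxE eqxx.
  rewrite dE mxE exchange_big; apply: eq_bigr => l _.
  rewrite !mxE mulr_suml; apply: eq_bigr => k _.
  by rewrite conjCK mulrAC.
exists (\matrix_(r, l) (sqrtC (d 0 r) * U r l)) => k l.
rewrite QE mul_mx_diag mxE; apply: eq_bigr => r _.
have /geC0_conj sE : 0 <= sqrtC (d 0 r) by rewrite sqrtC_ge0.
rewrite !mxE rmorphM /= sE mulrACA -expr2 sqrtCK mulrA.
by rewrite [_ * d 0 r]mulrC.
Qed.

Section CompletePositivity.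
Variables (R : realType).
Local Notation C := R[i].

Lemma mx_op_form (H : hilbert R) p (X : 'M[bop H]_p) (x : hsum p H) :
  hdot (hsum p H) (mx_op X x) x = \sum_k \sum_l hdot H (X k l (x l)) (x k).
Proof.
by apply: eq_bigr => k _; rewrite ffunE dot_suml.
Qed.

Variables (H K : hilbert R) (S : set (bop H)) (phi : bop H -> bop K).

(** Writing the positive matrix of the <P xi_l, xi_k> as a sum of rank one
matrices (conj (B r k) * B r l) turns the quadratic form of
(<phi (X k l) v, v> P) at xi into the sum over r of the quadratic form of
phi X at the vectors (B r l v)_l. *)
Lemma vector_state_cp (v : K) (L : hilbert R) (P : bop L) :
  completely_positive S phi -> positive_op P ->
  completely_positive S (fun x => hdot K (phi x v) v *: P).
Proof.
move=> phi_cp P0 p X SX X0 xi; rewrite mx_op_form.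
have [k l|c|B BE] := @gram_decomposition R p (\matrix_(k, l) hdot L (P (xi l)) (xi k)).
- by rewrite !mxE -dotC -[in RHS](positive_op_adj P0) -adjP.
- have := P0 (\sum_l c l *: xi l); congr (0 <= _).
  rewrite bop_sumr dot_sumr; apply: eq_bigr => k _.
  rewrite dot_suml; apply: eq_bigr => l _.
  by rewrite bopZ dotZl dotZr mxE mulrCA mulrA.
have := phi_cp p X SX X0 => phiX.
have -> : \sum_k \sum_l hdot L (map_mx (fun x => hdot K (phi x v) v *: P) X k l (xi l)) (xi k)
    = \sum_r hdot (hsum p K) (mx_op (map_mx phi X) [ffun l => B r l *: v])
        [ffun l => B r l *: v].
  under [RHS]eq_bigr do rewrite mx_op_form.
  rewrite [RHS]exchange_big; apply: eq_bigr => k _.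
  rewrite [RHS]exchange_big; apply: eq_bigr => l _.
  have := BE k l; rewrite !mxE => PE.
  rewrite dotZl PE mulr_sumr; apply: eq_bigr => r _.
  by rewrite !ffunE bopZ dotZl dotZr; ring.
by apply: sumr_ge0 => r _; exact: phiX.
Qed.

Lemma completely_positive_sum (L : hilbert R) (I : finType) (f : I -> bop H -> bop L) :
  (forall i, completely_positive S (f i)) ->
  completely_positive S (fun x => \sum_i f i x).
Proof.
move=> fcp p X SX X0 xi; rewrite mx_op_form.
have -> : \sum_k \sum_l hdot L (map_mx (fun x => \sum_i f i x) X k l (xi l)) (xi k)
    = \sum_k \sum_i \sum_l hdot L (map_mx (f i) X k l (xi l)) (xi k).
  apply: eq_bigr => k _; rewrite exchange_big; apply: eq_bigr => l _.
  by rewrite mxE bop_sum dot_suml; apply: eq_bigr => i _; rewrite mxE.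
rewrite exchange_big /= sumr_ge0// => i _.
by have := fcp i p X SX X0 xi; rewrite mx_op_form.
Qed.
End CompletePositivity.

(** * Bases inside a set of vectors *)

(** A maximal free family of members of W spans W. The nonzero
member w0 makes the family nonempty. *)
Lemma free_family_spanning (F : fieldType) d (W : set 'rV[F]_d) (w0 : 'rV[F]_d) :
    W w0 -> w0 != 0 ->
  exists m (M : 'M[F]_(m.+1, d)),
    [/\ row_free M, forall i, W (row i M) & forall w, W w -> (w <= M)%MS].
Proof.
move=> Ww0 w0n0.
pose Pr (r : nat) := `[< exists M : 'M[F]_(r, d), row_free M /\ forall i, W (row i M) >].
have exP : exists r, Pr r.
  exists 0%N; apply/asboolP; exists 0; split; last by case.
  by rewrite /row_free mxrank0.
have bdP r : Pr r -> (r <= d)%N.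
  by move=> /asboolP[M [/eqP Mf _]]; rewrite -[r in (r <= _)%N]Mf rank_leq_col.
case: (ex_maxnP exP bdP) => r /asboolP[M [Mf MW]] rmax.
have span w : W w -> (w <= M)%MS.
  move=> Ww; case: (boolP (w <= M)%MS) => // wM.
  suff /rmax : Pr (1 + r)%N by rewrite ltnn.
  apply/asboolP; exists (col_mx w M); split.
    have : (\rank M < \rank (w + M)%MS)%N.
      by apply: rank_ltmx; rewrite ltmxE addsmxSr addsmx_sub negb_and wM.
    by rewrite (eqP Mf) addsmxE => rM; rewrite /row_free eqn_leq rank_leq_row.
  move=> i; case: (split_ordP i) => j ->; rewrite ?rowKu ?rowKd //.
  by rewrite [row j w](_ : _ = w)//; apply/rowP => k; rewrite mxE [j]ord1.
case: r M Mf MW span {rmax} => [|r] M Mf MW span; last by exists r, M.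
by have := mxrankS (span _ Ww0); rewrite [M]flatmx0 mxrank0 leqn0 mxrank_eq0 (negPf w0n0).
Qed.

(** * The operator systems SOH(n) *)

Section SOHFacts.
Variables (R : realType) (n : nat) (E : OH_inclusion R n).
Local Notation C := R[i].

(** A single family, with the unit at index [ord0], so that an element of
SOH(n) is given by a vector of n + 1 coordinates. *)
Definition SOH_basis (i : 'I_n.+1) : bop (SOH_space E) :=
  oapp (SOH_gen E) (bop_id _) (unlift ord0 i).

Lemma SOH_basis0 : SOH_basis ord0 = bop_id _.
Proof. by rewrite /SOH_basis unlift_none. Qed.

Lemma SOH_basisS i : SOH_basis (lift ord0 i) = SOH_gen E i.
Proof. by rewrite /SOH_basis liftK. Qed.

Lemma SOHP T : SOH E T <-> exists a : 'I_n.+1 -> C, T = \sum_i a i *: SOH_basis i.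
Proof.
split=> [[a0 [a ->]]|[a ->]].
  exists (oapp a a0 \o unlift ord0).
  rewrite big_ord_recl SOH_basis0 /= unlift_none; congr (_ + _).
  by apply: eq_bigr => i _; rewrite SOH_basisS liftK.
exists (a ord0), (a \o lift ord0).
rewrite big_ord_recl SOH_basis0; congr (_ + _).
by apply: eq_bigr => i _; rewrite SOH_basisS.
Qed.

Lemma SOH_basis_in i : SOH E (SOH_basis i).
Proof.
apply/SOHP; exists (fun j => (j == i)%:R).
rewrite (bigD1 i)//= eqxx scale1r big1 ?addr0// => j /negPf ->.
by rewrite scale0r.
Qed.

Lemma SOH_subspace : subspace (SOH E).
Proof.
split=> [|a u v /SOHP[c ->] /SOHP[d ->]].
  by apply/SOHP; exists (fun=> 0); rewrite big1// => i _; rewrite scale0r.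
apply/SOHP; exists (fun i => a * c i + d i).
rewrite scaler_sumr -big_split; apply: eq_bigr => i _ /=.
by rewrite scalerDl scalerA.
Qed.

Lemma SOH_gen_app i (x : SOH_space E) (k : 'I_2) :
  SOH_gen E i x k =
    if k == ord0 then oh_basis E i (x ord_max) else adj (oh_basis E i) (x ord0).
Proof.
rewrite ffunE big_ord_recr big_ord1 /=.
have -> : widen_ord (leqnSn 1) ord0 = lshift 1 ord0 :> 'I_(1 + 1) by apply/val_inj.
have -> : ord_max = rshift 1 ord0 :> 'I_(1 + 1) by apply/val_inj.
have -> : ord0 = lshift 1 ord0 :> 'I_(1 + 1) by apply/val_inj.
case: (@split_ordP 1 1 k) => j ->; rewrite [j]ord1.
  by rewrite eqxx block_mxEul block_mxEur !mxE add0r.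
by rewrite block_mxEdl block_mxEdr !mxE addr0.
Qed.

Lemma SOH_space_dot (x y : SOH_space E) : hdot (SOH_space E) x y =
  hdot E (x ord0) (y ord0) + hdot E (x ord_max) (y ord_max).
Proof.
rewrite [LHS]big_ord_recr big_ord1 /=.
by congr (hdot _ (x _) (y _) + _); apply: val_inj.
Qed.

Lemma adj_SOH_basis i : adj (SOH_basis i) = SOH_basis i.
Proof.
apply: adj_unique => x y.
case: (unliftP ord0 i) => [j|] ->; last by rewrite SOH_basis0.
rewrite SOH_basisS !SOH_space_dot !SOH_gen_app /= addrC.
by congr (_ + _); [rewrite dotC -adjP -dotC | exact: adjP].
Qed.

Lemma SOH_adj : selfadjoint_set (SOH E).
Proof.
move=> T /SOHP[a ->]; apply/SOHP; exists (fun i => (a i)^*).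
apply: adj_unique => x y; rewrite !bop_sum dot_suml dot_sumr.
apply: eq_bigr => i _; rewrite !bop_scaleE dotZl dotZr conjCK.
by rewrite adjP adj_SOH_basis.
Qed.

Lemma SOH_space_neq0 : exists x : SOH_space E, x != 0.
Proof.
have [x x0] := oh_neq0 E; exists [ffun=> x].
by apply: contra x0 => /eqP/ffunP/(_ ord0); rewrite !ffunE => ->.
Qed.

Lemma SOH_operator_system : operator_system (SOH E).
Proof.
split; [exact: SOH_space_neq0|exact: SOH_subspace|exact: SOH_adj|].
by rewrite -SOH_basis0; exact: SOH_basis_in.
Qed.

(** If the sum of the a_i e_i is 0, the norm formula for 1 x 1 matrices gives
\sum_i |a_i|^2 = 0. *)
Lemma oh_basis_free (a : 'I_n -> C) :
  \sum_i a i *: oh_basis E i = 0 -> forall i, a i = 0.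
Proof.
move=> ae0.
have := oh_norm E (fun i => (a i)%:M : 'M_1).
have -> : \matrix_(k, l) \sum_i ((a i)%:M : 'M_1) k l *: oh_basis E i = 0 :> 'M[bop E]_1.
  apply/matrixP => k l; rewrite !mxE -[RHS]ae0; apply: eq_bigr => i _.
  by rewrite mxE !ord1 eqxx.
set A := (X in mxnorm X); set N := hnorm (hdot (hsum 1 E)) => norm0.
have : opnorm N (mx_op (0 : 'M[bop E]_1)) = 0.
  have N0 x : N (mx_op (0 : 'M[bop E]_1) x) = 0.
    rewrite [mx_op _ _](_ : _ = 0); first exact: hnorm0.
    by apply/ffunP => k; rewrite !ffunE big1// => l _; rewrite mxE.
  rewrite /opnorm [X in sup X](_ : _ = [set 0]) ?sup1//.
  apply/seteqP; split=> [_ [x _ <-]|_ ->]; first exact: N0.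
  by exists 0; [rewrite /= /N hnorm0|exact: N0].
rewrite norm0 => /eqP; rewrite sqrtr_eq0 => {norm0} normA i.
have AE k l : A k l = \sum_j `|a j| ^+ 2.
  rewrite /A summxE; apply: eq_bigr => j _.
  by rewrite !mxE !ord1 !eqxx normCK.
(* A is the 1 x 1 matrix with entry s, and its norm is at least that of its
   value at the unit vector. *)
pose s := complex.Re (\sum_j `|a j| ^+ 2).
have sE : \sum_j `|a j| ^+ 2 = s%:C%C.
  by rewrite /s RRe_real// ger0_real// sumr_ge0// => j _; exact: exprn_ge0.
have s0 : 0 <= s.
  by rewrite -(lecR 0) -sE sumr_ge0// => j _; exact: exprn_ge0.
pose nv (v : 'cV[C]_(1 * 1)) := hnorm (@dotmx _ (1 * 1)) v^T.
have nvA v : nv (A *m v) = s * nv v.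
  rewrite /nv [(A *m v)^T](_ : _ = s%:C%C *: v^T).
    rewrite /hnorm dnormZ ger0_norm ?lecR// -rmorphXn.
    by rewrite Re_realM sqrtrM ?sqr_ge0// sqrtr_sqr ger0_norm.
  apply/matrixP => k l; rewrite !mxE big_ord1 AE sE.
  by congr (_ * v _ _); exact/esym/(@ord1 l).
have nv1 : nv (const_mx 1) = 1.
  rewrite /nv /hnorm [X in complex.Re X](_ : _ = 1) ?sqrtr1//.
  by rewrite [LHS]dotmxE mxE big_ord1 !mxE mul1r rmorph1.
have in_ball : [set v | nv v <= 1] (const_mx 1) by rewrite /mkset nv1.
have : s <= 0.
  apply: le_trans normA; rewrite -[s]mulr1 -nv1 -nvA.
  apply: sup_upper_bound; last by exists (const_mx 1); [exact: in_ball|reflexivity].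
  split; first by eexists; exists (const_mx 1); [exact: in_ball|reflexivity].
  exists s => _ [v /= v1 <-]; rewrite -/(nv _) nvA.
  by rewrite ler_piMr.
move=> s0'; have {s0'} {}s0 : s = 0 by apply/le_anti; rewrite s0 s0'.
move: sE; rewrite s0 => /psumr_eq0P a0; apply/eqP.
by rewrite -normr_eq0 -sqrf_eq0 a0// => j _; exact: exprn_ge0.
Qed.

(** The diagonal blocks of a linear combination see only the coefficient of
the unit, the off-diagonal ones only the e_i. *)
Lemma SOH_basis_free (a : 'I_n.+1 -> C) :
  \sum_i a i *: SOH_basis i = 0 -> forall i, a i = 0.
Proof.
rewrite big_ord_recl SOH_basis0 => a0.
have eqn (y : SOH_space E) : a ord0 *: y ord0 +
    \sum_i a (lift ord0 i) *: oh_basis E i (y ord_max) = 0.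
  transitivity ((0 : bop (SOH_space E)) y ord0); last by rewrite ffunE.
  rewrite -a0 bop_addE bop_scaleE bop_sum !ffunE sum_ffunE; congr (_ + _).
  by apply: eq_bigr => i _; rewrite bop_scaleE SOH_basisS ffunE SOH_gen_app.
have [x x0] := oh_neq0 E.
have a00 : a ord0 = 0.
  have := eqn [ffun k => if k == ord0 then x else 0].
  rewrite !ffunE /= big1 ?addr0 => [|i _]; last by rewrite linear0 scaler0.
  by move/eqP; rewrite scaler_eq0 (negPf x0) orbF => /eqP.
move=> i; case: (unliftP ord0 i) => [j|] -> //.
apply: (oh_basis_free (a := a \o lift ord0)); apply/val_inj/funext => z.
have := eqn [ffun=> z]; rewrite !ffunE a00 scale0r add0r => az.
by rewrite /= bop_sum; exact: az.
Qed.
End SOHFacts.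

(** * Positive elements *)

Section PositiveOperators.
Variables (R : realType) (H : hilbert R).

Lemma positive_op_id : positive_op (bop_id H).
Proof. by move=> x; exact: dnorm_ge0. Qed.

Lemma positive_opD (T S : bop H) : positive_op T -> positive_op S -> positive_op (T + S).
Proof. by move=> T0 S0 x; rewrite bop_addE dotDl addr_ge0. Qed.

Lemma positive_opZ (a : R[i]) (T : bop H) : 0 <= a -> positive_op T -> positive_op (a *: T).
Proof. by move=> a0 T0 x; rewrite bop_scaleE dotZl mulr_ge0. Qed.

Lemma positive_op_sum (I : finType) (T : I -> bop H) :
  (forall i, positive_op (T i)) -> positive_op (\sum_i T i).
Proof. by move=> T0 x; rewrite bop_sum dot_suml sumr_ge0// => i _; exact: T0. Qed.

(** If |T x|^2 <= M |x|^2, then <T x, x> is real and at most sqrt M |x|^2 in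
absolute value; d = 1 / (1 + M) is a rational expression with d sqrt M <= 1. *)
Lemma selfadjoint_order_bound (T : bop H) : adj T = T -> exists2 d : R[i], 0 < d &
  positive_op (bop_id H + d *: T) /\ positive_op (bop_id H + (- d) *: T).
Proof.
move=> Tadj; have /bounded_opP[_ [M [M0 TM]]] := bop_funP T.
pose d := (1 + M)^-1.
have d0 : 0 < d by rewrite invr_gt0; lra.
exists d%:C%C; first by rewrite ltcR.
have Tx x : hdot H (T x) x = (redot (T x) x)%:C%C.
  rewrite RRe_real//; apply/CrealP.
  by rewrite -dotC -{1}Tadj -adjP.
have bound x : `|d * redot (T x) x| <= redot x x.
  rewrite -ler_sqr ?nnegrE ?redot_ge0// real_normK ?num_real// exprMn.
  have h : redot (T x) x ^+ 2 <= M * redot x x ^+ 2.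
    apply: le_trans (redot_cauchy _ _) _.
    by rewrite expr2 mulrA ler_wpM2r ?redot_ge0//; exact: TM.
  rewrite (le_trans (ler_wpM2l (sqr_ge0 d) h))// mulrA ler_piMl ?sqr_ge0//.
  have -> : d ^+ 2 * M = M / (1 + M) ^+ 2 by rewrite /d exprVn mulrC.
  by rewrite ler_pdivrMr ?exprn_gt0//; [rewrite mul1r; nra|lra].
have bl x := ler_norml (d * redot (T x) x) (redot x x).
split=> x; rewrite bop_addE bop_scaleE dotDl dotZl Tx [hdot H (bop_id H x) x]dotxx.
  rewrite -rmorphM -rmorphD lecR /=.
  by have := bound x; rewrite bl => /andP[]; lra.
rewrite -rmorphN -rmorphM -rmorphD lecR /=.
by have := bound x; rewrite bl => /andP[]; lra.
Qed.

End PositiveOperators.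

(** P_i = w (1 + d_i H_i) for i > 0, and P_0 = 1 - \sum_(i > 0) P_i. The weight
w = 1 / (2 (n + 1)) is small enough for P_0 to be positive, being
2 w 1 + \sum_i w (1 - d_i H_i). *)
Lemma SOH_positive_basis (R : realType) n (E : OH_inclusion R n) :
  exists P : 'I_n.+1 -> bop (SOH_space E),
    [/\ forall i, SOH E (P i), forall i, positive_op (P i),
        \sum_i P i = bop_id (SOH_space E),
        forall c : 'I_n.+1 -> R[i], \sum_i c i *: P i = 0 -> forall i, c i = 0
      & forall T, SOH E T -> exists c : 'I_n.+1 -> R[i], T = \sum_i c i *: P i].
Proof.
pose g := SOH_basis E; pose one := bop_id (SOH_space E).
have /choice[d dP] (i : 'I_n) : exists d : R[i], [/\ 0 < d,
    positive_op (one + d *: g (lift ord0 i)) & positive_op (one + (- d) *: g (lift ord0 i))].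
  have [d d0 [dp dm]] := selfadjoint_order_bound (adj_SOH_basis E (lift ord0 i)).
  by exists d; split; [exact: d0|exact: dp|exact: dm].
pose w : R[i] := (2 * n.+1%:R)^-1.
have w0 : 0 < w by rewrite invr_gt0 mulr_gt0.
have in_SOH (a0 : R[i]) (a : 'I_n -> R[i]) :
    SOH E (a0 *: one + \sum_j a j *: g (lift ord0 j)).
  by exists a0, a; under eq_bigr do rewrite /g SOH_basisS.
pose P' i := w *: (one + d i *: g (lift ord0 i)).
have [P [P0 PS]] : exists P : 'I_n.+1 -> bop (SOH_space E),
    P ord0 = one - \sum_j P' j /\ forall j, P (lift ord0 j) = P' j.
  exists (fun i => oapp P' (one - \sum_j P' j) (unlift ord0 i)).
  by split=> [|j]; rewrite ?unlift_none ?liftK.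
(* The change of basis: it gives both independence and spanning. *)
have PE c : \sum_i c i *: P i = (c ord0 + \sum_j w * (c (lift ord0 j) - c ord0)) *: one
     + \sum_j (w * d j * (c (lift ord0 j) - c ord0)) *: g (lift ord0 j).
  rewrite big_ord_recl P0 scalerBr scaler_sumr scalerDl scaler_suml -!addrA; congr (_ + _).
  rewrite addrC -sumrB -big_split; apply: eq_bigr => j _ /=.
  rewrite PS -scalerBl scalerA (mulrC _ w) scalerDr scalerA.
  by rewrite (mulrAC w (d j)).
exists P; split.
- move=> i; have -> : P i = \sum_j (j == i)%:R *: P j.
    rewrite (bigD1 i)//= eqxx scale1r big1 ?addr0// => j /negPf ->.
    by rewrite scale0r.
  by rewrite (PE (fun j => (j == i)%:R)); exact: in_SOH.
- move=> i; case: (unliftP ord0 i) => [j|] ->.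
    by rewrite PS; apply: positive_opZ; [exact: ltW|case: (dP j)].
  have -> : P ord0 = (2 * w) *: one + \sum_j w *: (one + (- d j) *: g (lift ord0 j)).
    rewrite P0; apply/eqP; rewrite subr_eq -addrA -big_split /=; apply/eqP.
    under eq_bigr do rewrite /P' -scalerDr addrACA -scalerDl addNr scale0r addr0.
    have -> : one + one = 2 *: one by rewrite scaler_nat.
    rewrite scalerA sumr_const card_ord scalerMnl -scalerDl.
    have -> : 2 * w + w * 2 *+ n = (2 * n.+1%:R) * w by rewrite -mulr_natl -natr1; ring.
    by rewrite mulfV ?scale1r// mulf_neq0 ?pnatr_eq0.
  apply: positive_opD.
    by apply: positive_opZ; [rewrite mulr_ge0// ltW|exact: positive_op_id].
  apply: positive_op_sum => j; apply: positive_opZ; first exact: ltW.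
  by case: (dP j).
- by rewrite big_ord_recl P0 (eq_bigr _ (fun j _ => PS j)) subrK.
- move=> c; rewrite PE => Pc0.
  pose a i := oapp (fun j => w * d j * (c (lift ord0 j) - c ord0))
    (c ord0 + \sum_j w * (c (lift ord0 j) - c ord0)) (unlift ord0 i).
  have a0 : forall i, a i = 0.
    apply: (@SOH_basis_free _ _ E).
    rewrite -[RHS]Pc0 big_ord_recl SOH_basis0 /a unlift_none; congr (_ + _).
    by apply: eq_bigr => j _; rewrite liftK.
  have cj j : c (lift ord0 j) - c ord0 = 0.
    have := a0 (lift ord0 j); rewrite /a liftK /= => /eqP.
    have [dj _ _] := dP j.
    by rewrite mulf_eq0 gt_eqF ?mulr_gt0//= => /eqP.
  have c0 : c ord0 = 0.
    have := a0 ord0; rewrite /a unlift_none /= big1 ?addr0// => j _.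
    by rewrite cj mulr0.
  move=> i; case: (unliftP ord0 i) => [j|] -> //.
  by have := cj j; rewrite c0 subr0.
- move=> T /SOHP[a ->].
  pose b j := (w * d j)^-1 * a (lift ord0 j).
  pose c0 := a ord0 - \sum_j w * b j.
  exists (fun i => oapp (fun j => b j + c0) c0 (unlift ord0 i)).
  rewrite PE big_ord_recl SOH_basis0 unlift_none /=.
  under [X in _ = (_ + X) *: _ + _]eq_bigr do rewrite liftK /= addrK.
  rewrite /c0 subrK; congr (_ + _); apply: eq_bigr => j _.
  rewrite liftK /= addrK /b mulVKf// mulf_neq0 ?gt_eqF//.
  by case: (dP j).
Qed.

(** * Vector states of a unital completely positive map *)

Lemma unit_multiple (R : realType) (K : hilbert R) (v : K) :
  v != 0 -> exists2 r, r != 0 & hdot K (r *: v) (r *: v) = 1.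
Proof.
move=> v0; have rr : (sqrtC (hdot K v v))^-1 != 0.
  by rewrite invr_eq0 sqrtC_eq0 dnorm_eq0.
exists (sqrtC (hdot K v v))^-1 => //.
rewrite dotZl dotZr geC0_conj ?invr_ge0 ?sqrtC_ge0 ?dnorm_ge0//.
by rewrite mulrA -expr2 exprVn sqrtCK mulVf ?dnorm_eq0.
Qed.

Section UcpMaps.
Variables (R : realType) (n : nat) (E : OH_inclusion R n).
Local Notation C := R[i].
Variables (K : hilbert R) (T : set (bop K)) (phi : bop (SOH_space E) -> bop K).
Hypothesis phi_ucp : ucp (SOH E) T phi.

Lemma ucp0 : phi 0 = 0.
Proof.
have [_ lin _ _] := phi_ucp; have [S0 _] := SOH_subspace E.
by have := lin (-1) 0 0 S0 S0; rewrite scaler0 addr0 scaleN1r addNr.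
Qed.

Lemma ucp_expand (a : 'I_n.+1 -> C) :
  phi (\sum_i a i *: SOH_basis E i) = \sum_i a i *: phi (SOH_basis E i).
Proof.
have [_ lin _ _] := phi_ucp; have [S0 SP] := SOH_subspace E.
suff: forall r : seq 'I_n.+1, SOH E (\sum_(i <- r) a i *: SOH_basis E i) /\
   phi (\sum_(i <- r) a i *: SOH_basis E i) = \sum_(i <- r) a i *: phi (SOH_basis E i).
  by move=> /(_ (index_enum _)) [].
elim=> [|i r [Sr phir]]; first by rewrite !big_nil ucp0.
have Si := SOH_basis_in E i.
by rewrite !big_cons lin// phir; split=> //; exact: SP.
Qed.

Lemma vector_states_kernel (x : bop (SOH_space E)) :
    (forall v, hdot K v v = 1 -> hdot K (phi x v) v = 0) -> phi x = 0.
Proof.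
move=> h; apply: quadratic_form_eq0 => v.
have [->|v0] := eqVneq v 0; first by rewrite linear0r.
have [r r0 /h/eqP] := unit_multiple v0.
by rewrite bopZ dotZl dotZr !mulf_eq0 fmorph_eq0 (negPf r0) => /eqP.
Qed.

(** A vector state is recorded by the row of its values on the basis of SOH(n),
and the v_i come from a maximal independent set of such rows, the rows of M.
Maximality makes them determine phi x; independence, i.e. right invertibility
of M, makes their values arbitrary. If there were n + 1 of them, M would be
left invertible and the kernel of phi zero. *)
Lemma separating_vector_states :
    (exists v : K, v != 0) -> kernel (SOH E) phi <> [set 0] ->
  exists m (v : 'I_m.+1 -> K),
    [/\ (m < n)%N, forall i, hdot K (v i) (v i) = 1,
        forall x, SOH E x -> (forall i, hdot K (phi x (v i)) (v i) = 0) -> phi x = 0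
      & forall c : 'I_m.+1 -> C, exists2 x, SOH E x &
          forall i, hdot K (phi x (v i)) (v i) = c i].
Proof.
move=> K_neq0 kerN0; have [_ _ phi1 _] := phi_ucp.
pose state v := \row_i hdot K (phi (SOH_basis E i) v) v.
have stateE v (a : 'I_n.+1 -> C) :
    hdot K (phi (\sum_i a i *: SOH_basis E i) v) v = (state v *m \col_i a i) 0 0.
  rewrite ucp_expand bop_sum dot_suml mxE; apply: eq_bigr => i _.
  by rewrite bop_scaleE dotZl !mxE mulrC.
pose W : set 'rV[C]_n.+1 := [set state v | v in [set v | hdot K v v = 1]].
have [v1 v1E] : exists v, hdot K v v = 1.
  by have [v /unit_multiple[r _ rv]] := K_neq0; exists (r *: v).
have state_neq0 : state v1 != 0.
  apply/eqP => /rowP/(_ ord0); rewrite !mxE SOH_basis0 phi1 v1E => /eqP.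
  by rewrite oner_eq0.
have [|m [M [Mfree MW Wspan]]] := @free_family_spanning _ _ W (state v1) _ state_neq0.
  by exists v1.
have /choice[v vP] i : exists v, hdot K v v = 1 /\ state v = row i M.
  by have [v vv <-] := MW i; exists v.
have MaE i (a : 'I_n.+1 -> C) : hdot K (phi (\sum_i a i *: SOH_basis E i) (v i)) (v i)
    = (M *m \col_i a i) i 0.
  by have [_ vE] := vP i; rewrite stateE vE -row_mul mxE.
exists m, v; split.
- rewrite -ltnS -(eqP Mfree) ltn_neqAle rank_leq_col andbT; apply/negP => Mfull.
  apply: kerN0; apply/seteqP; split=> [x [/SOHP[a ->] phix]|_ ->].
    have : (M *m \col_i a i) = 0.
      apply/matrixP => i j; rewrite [j]ord1 -MaE phix [RHS]mxE.
      by rewrite [(0 : bop K) _]/(0 : K) linear0l.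
    move/(congr1 (mulmx (pinvmx M))).
    rewrite mulmx0 mulmxA mulVpmx// mul1mx => /matrixP a0.
    rewrite /= big1// => i _; have := a0 i 0; rewrite !mxE => ->; exact: scale0r.
  by have [S0 _] := SOH_subspace E; split=> //; exact: ucp0.
- by move=> i; case: (vP i).
- move=> x /SOHP[a ->] phix; apply: vector_states_kernel => w ww.
  have /submxP[D wE] : (state w <= M)%MS by apply: Wspan; exists w.
  rewrite stateE wE -mulmxA (_ : M *m _ = 0) ?mulmx0 ?mxE//.
  by apply/matrixP => i j; rewrite [j]ord1 -MaE phix mxE.
- move=> c; pose a := pinvmx M *m \col_i c i.
  exists (\sum_i a i 0 *: SOH_basis E i); first by apply/SOHP; exists (a^~ 0).
  move=> i; rewrite MaE (_ : \col_i a i 0 = a); last by apply/colP => j; rewrite mxE.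
  by rewrite /a mulmxA mulmxVp// mul1mx mxE.
Qed.

(** Any unital completely positive map whose kernel is cut out by k + 1 vector
states can be replaced, with the same kernel, by one with values in SOH(k):
attach each state to one member of a positive basis. *)
Lemma replace_codomain k (F : OH_inclusion R k) (v : 'I_k.+1 -> K) :
    (forall i, hdot K (v i) (v i) = 1) ->
    (forall x, SOH E x -> (forall i, hdot K (phi x (v i)) (v i) = 0) -> phi x = 0) ->
  exists psi : bop (SOH_space E) -> bop (SOH_space F),
    [/\ ucp (SOH E) (SOH F) psi, kernel (SOH E) psi = kernel (SOH E) phi
      & (forall c : 'I_k.+1 -> C, exists2 x, SOH E x &
          forall i, hdot K (phi x (v i)) (v i) = c i) ->
        psi @` SOH E = SOH F].
Proof.
move=> v1 sep; have [_ lin phi1 phi_cp] := phi_ucp.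
have [P [SP P0 P1 Pfree Pspan]] := SOH_positive_basis F.
pose psi x := \sum_i hdot K (phi x (v i)) (v i) *: P i.
have psi_in x : SOH F (psi x).
  have [F0 FP] := SOH_subspace F; apply: (big_ind (SOH F)) => // [y z Fy Fz|i _].
    by rewrite -[y]scale1r; exact: FP.
  by rewrite -[_ *: _]addr0; exact: FP.
exists psi; split.
- split.
  + by move=> x _.
  + move=> a x y Sx Sy; rewrite /psi lin// scaler_sumr -big_split; apply: eq_bigr => i _ /=.
    by rewrite dotDl dotZl scalerDl scalerA.
  + by rewrite /psi phi1 -P1; apply: eq_bigr => i _; rewrite v1 scale1r.
  + apply: (@completely_positive_sum _ _ (SOH E) _ _
      (fun i x => hdot K (phi x (v i)) (v i) *: P i)) => i.
    exact: vector_state_cp.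
- apply/seteqP; split=> x [Sx x0]; split=> //.
    by apply: sep => //; exact: Pfree.
  by rewrite /psi x0 big1// => i _; rewrite [(0 : bop K) _]/(0 : K) linear0l scale0r.
- move=> surj; apply/seteqP; split=> [_ [x _ <-]//|y /Pspan[c ->]].
  have [x Sx xc] := surj c; exists x => //.
  by apply: eq_bigr => i _; rewrite xc.
Qed.
End UcpMaps.

Theorem proposition4p4 (R : realType) (E : forall k : nat, OH_inclusion R k)
  (n : nat) (hn : (1 <= n)%N) (J : set (bop (SOH_space (E n))))
  (J_sub : subspace J) (J_SOH : J `<=` SOH (E n))
  (J_adj : selfadjoint_set J) (J_nontrivial : J <> [set 0]) :
  ((exists (K : hilbert R) (T : set (bop K)) (phi : bop (SOH_space (E n)) -> bop K),
      [/\ operator_system T, ucp (SOH (E n)) T phi & J = kernel (SOH (E n)) phi])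
   <->
   (exists (m : nat) (phi : bop (SOH_space (E n)) -> bop (SOH_space (E m))),
      [/\ (m < n)%N, ucp (SOH (E n)) (SOH (E m)) phi,
          phi @` SOH (E n) = SOH (E m) & J = kernel (SOH (E n)) phi]))
  /\
  ((exists (m : nat) (phi : bop (SOH_space (E n)) -> bop (SOH_space (E m))),
      [/\ (m < n)%N, ucp (SOH (E n)) (SOH (E m)) phi,
          phi @` SOH (E n) = SOH (E m) & J = kernel (SOH (E n)) phi])
   <->
   (exists phi : bop (SOH_space (E n)) -> bop (SOH_space (E n)),
      ucp (SOH (E n)) (SOH (E n)) phi /\ J = kernel (SOH (E n)) phi)).
Proof.
pose is_kernel := exists (K : hilbert R) (T : set (bop K))
    (phi : bop (SOH_space (E n)) -> bop K),
  [/\ operator_system T, ucp (SOH (E n)) T phi & J = kernel (SOH (E n)) phi].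
have of_SOH (m : nat) (phi : bop (SOH_space (E n)) -> bop (SOH_space (E m))) :
    ucp (SOH (E n)) (SOH (E m)) phi -> J = kernel (SOH (E n)) phi -> is_kernel.
  move=> ? ?; exists (SOH_space (E m)), (SOH (E m)), phi; split=> //.
  exact: SOH_operator_system.
have onto_smaller : is_kernel ->
    exists (m : nat) (phi : bop (SOH_space (E n)) -> bop (SOH_space (E m))),
      [/\ (m < n)%N, ucp (SOH (E n)) (SOH (E m)) phi,
          phi @` SOH (E n) = SOH (E m) & J = kernel (SOH (E n)) phi].
  move=> [K [T [phi [[K0 _ _ _] phi_ucp Jker]]]]; rewrite Jker in J_nontrivial.
  have [m [v [mn v1 sep surj]]] := separating_vector_states phi_ucp K0 J_nontrivial.
  have [psi [psi_ucp psi_ker /(_ surj) psi_surj]] := replace_codomain phi_ucp (E m) v1 sep.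
  by exists m, psi; split=> //; rewrite psi_ker.
have endomorphism : is_kernel ->
    exists phi : bop (SOH_space (E n)) -> bop (SOH_space (E n)),
      ucp (SOH (E n)) (SOH (E n)) phi /\ J = kernel (SOH (E n)) phi.
  move=> [K [T [phi [[K0 _ _ _] phi_ucp Jker]]]]; rewrite Jker in J_nontrivial.
  have [m [v [mn v1 sep _]]] := separating_vector_states phi_ucp K0 J_nontrivial.
  (* There are m + 1 <= n states for n + 1 basis elements; those beyond m
     receive a repeated state, the default value of inord. *)
  have [i|x Sx x0|psi [psi_ucp psi_ker _]] :=
      @replace_codomain _ _ _ _ _ _ phi_ucp n (E n) (fun i => v (inord i)).
  - exact: v1.
  - apply: sep => // i; have := x0 (inord i).
    by rewrite inordK ?inord_val// (leq_trans (ltn_ord i))// ltnW.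
  - by exists psi; rewrite psi_ker.
split; split.
- exact: onto_smaller.
- by move=> [m [phi [_ phi_ucp _ Jker]]]; exact: of_SOH phi_ucp Jker.
- by move=> [m [phi [_ phi_ucp _ Jker]]]; exact/endomorphism/(of_SOH _ _ phi_ucp Jker).
- by move=> [phi [phi_ucp Jker]]; exact/onto_smaller/(of_SOH _ _ phi_ucp Jker).
Qed.
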